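(* Let $(t_n)_{n\ge0}$ be a toll sequence with $t_0=0$, and let $(f_n)_{n\ge0}$ be defined by $f_0=0$ and \[ f_n=t_n+\frac{2}{n}\sum_{k=0}^{n-1}f_k\qquad(n\ge1). \] If $t_n=n^{\alpha}$ ($n\ge1$) for a fixed $\alpha>0$, or $t_n=\log n$ ($n\ge1$), then $f_n$ admits a full asymptotic expansion as $n\to\infty$ in descending powers of $n$ and integral powers of $\log n$. Moreover, with $\gamma$ Euler's constant: - if $\alpha>2$: $f_n=\frac{\alpha+1}{\alpha-1}n^{\alpha}+O(n^{\alpha-1})$; - if $\alpha=2$: $f_n=3n^2-6n\log n+(10-6\gamma)n+O(\log n)$; - if $1<\alpha<2$: there is a constant $K_\alpha$ such that $f_n=\frac{\alpha+1}{\alpha-1}n^{\alpha}+K_\alpha n+O(n^{\alpha-1})$; - if $\alpha=1$: $f_n=2n\log n+(2\gamma-3)n+2\log n+2\gamma+1+O(1/n)$; - if $0<\alpha<1$: $f_n=K_\alpha n+\frac{\alpha+1}{\alpha-1}n^{\alpha}+K_\alpha+o(1)$, where $K_\alpha=2\sum_{n\ge1}\frac{n^{\alpha}}{(n+1)(n+2)}$; - if $t_n=\log n$: $f_n=K_0'n-\log n+(K_0'-2)-\frac{1}{2n}+\frac{1}{9n^2}+O(1/n^3)$, where $K_0'=2\sum_{n\ge1}\frac{\log n}{(n+1)(n+2)}$.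
   Context: This recurrence gives the expected cost induced by tolls $t_n$ in the binary search tree (quicksort) model, where a tree of size $n$ has left subtree size uniform on $\{0,\dots,n-1\}$. *)

(* Defs.v *)
From mathcomp Require Export all_boot all_order all_algebra.
From mathcomp Require Export all_classical all_reals all_analysis.

Set Implicit Arguments.
Unset Strict Implicit.
Unset Printing Implicit Defensive.

Import Order.TTheory GRing.Theory Num.Theory.
Import numFieldNormedType.Exports.

Local Open Scope classical_set_scope.
Local Open Scope ring_scope.

Section defs.
Context {R : realType}.

Definition bst_recurrence (t f : nat -> R) : Prop :=
  f 0%N = 0 /\
  forall n : nat, (1 <= n)%N -> f n = t n + 2 / n%:R * \sum_(0 <= k < n) f k.

Definition euler_gamma : R :=
  limn (fun n : nat => \sum_(1 <= k < n.+1) (k%:R : R)^-1 - ln n%:R).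

Definition K_pow (alpha : R) : R :=
  2 * \big[+%R/0]_(1 <= n <oo) (n%:R `^ alpha / ((n%:R + 1) * (n%:R + 2))).

Definition K_log : R :=
  2 * \big[+%R/0]_(1 <= n <oo) (ln n%:R / ((n%:R + 1) * (n%:R + 2))).

Definition power_log (a : R) (m : int) (n : nat) : R :=
  n%:R `^ a * ln n%:R ^ m.

(* A Poincare expansion along a scale n^(a_j) (log n)^(m_j), strictly
   descending in the order of growth.  The requirement a_j -> -oo makes the
   expansion full: it determines f up to any negative power of n.  Zero
   coefficients are allowed, so expansions with finitely many terms are
   covered. *)
Definition full_power_log_expansion (f : nat -> R) : Prop :=
  exists (a : nat -> R) (m : nat -> int) (c : nat -> R),
    [/\ forall j, a j.+1 < a j \/ (a j.+1 = a j /\ m j.+1 < m j),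
        a @ \oo --> -oo &
        forall J : nat,
          f = (fun n => \sum_(0 <= j < J.+1) c j * power_log (a j) (m j) n)
              +o_\oo power_log (a J) (m J)].

End defs.

(* Main.v *)
Require Import Defs.
From mathcomp Require Import ring lra zify.

Set Implicit Arguments.
Unset Strict Implicit.
Unset Printing Implicit Defensive.

Import Order.TTheory GRing.Theory Num.Theory.
Import numFieldNormedType.Exports.

Local Open Scope classical_set_scope.
Local Open Scope ring_scope.

(** Put [T n = f n - t n] and [D u n = (n + 1) u (n + 1) - (n + 2) u n].  The
    recurrence becomes [D T = 2 t] with [T 1 = 0].  Since
    [D (n^b) = (b - 1) n^b + O(n^(b-1))], a right-hand side with an expansion in
    descending powers can be matched term by term, except at the exponent 1,
    where [D ((n + 1) log n) = (n + 1) (n + 2) log (1 + 1/n) = n + O(1)] takes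
    over.  Dividing [D u = O(n^b)] by [(n + 1) (n + 2)] and telescoping
    [u n / (n + 1)] shows that the error is [K (n + 1) + O(n^b)] if [b < 1], and
    [O(n^b)] if [b > 1].  Finally [T n / (n + 1)] is the partial sum
    [2 sum_(k < n) t k / ((k + 1) (k + 2))], which identifies [K]; for
    [alpha = 1, 2] the cost is explicit in terms of harmonic numbers. *)

(** * Taylor bounds on [0, 1] for (1 + x)^b and log (1 + x) *)

Section taylor.
Context {R : realType}.
Implicit Types (b x C : R) (M i : nat).

(** The generalized binomial coefficient of a real [b]. The recursion lowers [b], as differentiating
    (1 + x)^b does. *)
Fixpoint gbinom b i : R :=
  if i is j.+1 then b / j.+1%:R * gbinom (b - 1) j else 1.

(** By the mean value theorem h(x) = x h'(c) with 0 < c < x, and c^M <= x^M. *)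
Lemma normr_le_of_derive (h dh : R -> R) C M :
  (forall x, 0 <= x -> is_derive x 1 h (dh x)) -> h 0 = 0 ->
  (forall x, 0 <= x <= 1 -> `|dh x| <= C * x ^+ M) ->
  forall x, 0 <= x <= 1 -> `|h x| <= C * x ^+ M.+1.
Proof.
move=> dhP h0 dhC x /andP[x0 x1].
have [|| c] := @MVT_segment R h dh 0 x x0.
- by move=> y; rewrite in_itv /= => /andP[y0 _]; apply: dhP; exact: ltW.
- apply: derivable_within_continuous => y; rewrite in_itv /= => /andP[y0 _].
  by have [] := dhP y y0.
rewrite in_itv /= => /andP[c0 cx]; rewrite h0 !subr0 => ->.
rewrite normrM (ger0_norm x0) exprSr mulrA ler_wpM2r//.
have C0 : 0 <= C.
  by have := dhC 1; rewrite ler01 lexx expr1n mulr1 => /(_ isT); apply: le_trans.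
apply: le_trans (dhC c _) _; first by rewrite c0 (le_trans cx).
by rewrite ler_wpM2l// lerXn2r ?nnegrE.
Qed.

Lemma is_derive_sumX (c : nat -> R) M x :
  is_derive x 1 (fun y => \sum_(i < M) c i / i.+1%:R * y ^+ i.+1)
    (\sum_(i < M) c i * x ^+ i).
Proof.
have -> : (fun y => \sum_(i < M) c i / i.+1%:R * y ^+ i.+1) =
    \sum_(i < M) ((c i / i.+1%:R) \*: ((id : R -> R) ^+ i.+1)).
  by apply/funext => y; rewrite fct_sumE; apply: eq_bigr => i _; rewrite exprfctE.
apply: is_derive_sum => i.
apply: is_derive_eq.
have : i.+1%:R != 0 :> R by rewrite pnatr_eq0.
by move=> ?; rewrite /GRing.scale /= mulr1; field.
Qed.

Lemma is_derive_powR1D b x : 0 <= x ->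
  is_derive x 1 (fun y => (1 + y) `^ b) (b * (1 + x) `^ (b - 1)).
Proof.
move=> x0.
have x1 : 0 < 1 + x by rewrite ltr_wpDr.
have d1 : is_derive x 1 (fun y : R => 1 + y) 1.
  have -> : (fun y : R => 1 + y) = shift 1 by apply/funext => y; exact: addrC.
  exact: is_derive_shift.
have := is_derive1_comp (f := fun y : R => y `^ b) (g := fun y : R => 1 + y)
  (is_derive1_powR b x1) d1.
by rewrite mulr1.
Qed.

Lemma is_derive_ln1D x : 0 <= x ->
  is_derive x 1 (fun y => ln (1 + y)) (1 + x)^-1.
Proof.
move=> x0.
have x1 : 0 < 1 + x by rewrite ltr_wpDr.
have d1 : is_derive x 1 (fun y : R => 1 + y) 1.
  have -> : (fun y : R => 1 + y) = shift 1 by apply/funext => y; exact: addrC.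
  exact: is_derive_shift.
have := is_derive1_comp (f := @ln R) (g := fun y : R => 1 + y)
  (is_derive1_ln x1) d1.
by rewrite mulr1.
Qed.

(** Induction on [M] for all [b] at once: the remainder of length M + 1 for [b] vanishes at 0, and
    its derivative is [b] times the remainder of length M for b - 1. *)
Lemma powR1D_taylor b M : exists C, forall x, 0 <= x <= 1 ->
  `|(1 + x) `^ b - \sum_(i < M) gbinom b i * x ^+ i| <= C * x ^+ M.
Proof.
elim: M b => [|M IH] b.
  (* The absolute value covers negative [b]: (1 + x)^b <= (1 + x)^|b| <= 2^|b|. *)
  exists (2 `^ `|b|) => x /andP[x0 x1].
  rewrite big_ord0 subr0 mulr1 ger0_norm ?powR_ge0//.
  apply: (@le_trans _ _ ((1 + x) `^ `|b|)).
    by rewrite ler_powR ?ler_norm// lerDl.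
  by rewrite ge0_ler_powR ?nnegrE ?addr_ge0//; lra.
have [C CP] := IH (b - 1); exists (`|b| * C).
pose h x := (1 + x) `^ b - \sum_(i < M.+1) gbinom b i * x ^+ i.
pose dh x := b * ((1 + x) `^ (b - 1) - \sum_(i < M) gbinom (b - 1) i * x ^+ i).
apply: (@normr_le_of_derive h dh).
- move=> x x0; rewrite /h.
  have -> : (fun x => (1 + x) `^ b - \sum_(i < M.+1) gbinom b i * x ^+ i) =
     (fun x => (1 + x) `^ b) - (cst 1 : R -> R) -
     (fun y => \sum_(i < M) (b * gbinom (b - 1) i) / i.+1%:R * y ^+ i.+1).
    apply/funext => y; rewrite big_ord_recl /= expr0 mulr1 opprD addrA.
    rewrite !fctE; congr (_ - _ - _); apply: eq_bigr => i _.
    by rewrite /bump /= add1n; congr (_ * _); rewrite mulrAC.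
  have ? := is_derive_powR1D b x0.
  have ? := is_derive_sumX (fun i => b * gbinom (b - 1) i) M x.
  apply: is_derive_eq; rewrite subr0 /dh mulrBr mulr_sumr.
  by congr (_ - _); apply: eq_bigr => i _; rewrite mulrA.
- rewrite /h addr0 powR1 big_ord_recl /= expr0 mulr1 big1 ?addr0 ?subrr//.
  by move=> i _; rewrite /bump /= exprS mul0r mulr0.
- by move=> x x01; rewrite normrM -mulrA ler_wpM2l// CP.
Qed.

Definition ln1D_coef i : R := if i is j.+1 then gbinom (-1) j / i%:R else 0.

(** One integration of the binomial bound for (1 + x)^(-1), whose integrated coefficients are
    [ln1D_coef]. *)
Lemma ln1D_taylor M : exists C, forall x, 0 <= x <= 1 ->
  `|ln (1 + x) - \sum_(i < M.+1) ln1D_coef i * x ^+ i| <= C * x ^+ M.+1.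
Proof.
have [C CP] := powR1D_taylor (-1) M; exists C.
pose h x := ln (1 + x) - \sum_(i < M.+1) ln1D_coef i * x ^+ i.
pose dh x := (1 + x) `^ (-1) - \sum_(i < M) gbinom (-1) i * x ^+ i.
apply: (@normr_le_of_derive h dh) => //.
- move=> x x0; rewrite /h.
  have -> : (fun x => ln (1 + x) - \sum_(i < M.+1) ln1D_coef i * x ^+ i) =
     (fun x => ln (1 + x)) -
     (fun y => \sum_(i < M) gbinom (-1) i / i.+1%:R * y ^+ i.+1).
    by apply/funext => y; rewrite big_ord_recl /= mul0r add0r !fctE.
  have ? := is_derive_ln1D x0.
  have ? := is_derive_sumX (fun i => gbinom (-1) i) M x.
  by apply: is_derive_eq; rewrite /dh powR_inv1// addr_ge0.
- rewrite /h addr0 ln1 sub0r big1 ?oppr0// => -[[|i] ?] _ /=.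
    by rewrite mul0r.
  by rewrite exprS mul0r mulr0.
Qed.

End taylor.

(** * Bounds by powers, expansions in descending powers, and the operator [bst_diff] *)

Section power_bounds.
Context {R : realType}.
Implicit Types (b x C s : R) (M i n : nat) (d r u w : nat -> R).

(** The bound holds at every positive index and not just eventually, so telescoping needs no
    threshold; the index 1 forces C >= 0. *)
Definition powO b r : Prop :=
  exists C, forall n, (0 < n)%N -> `|r n| <= C * n%:R `^ b.

Lemma pnatr_gt0 n : (0 < n)%N -> 0 < n%:R :> R.
Proof. by rewrite ltr0n. Qed.

Lemma pnatr_ge1 n : (0 < n)%N -> 1 <= n%:R :> R.
Proof. by rewrite ler1n. Qed.

Lemma pnatr_neq0 n : (0 < n)%N -> n%:R != 0 :> R.
Proof. by move=> n0; rewrite pnatr_eq0 -lt0n. Qed.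

Lemma powRDn n a b : (0 < n)%N -> n%:R `^ (a + b) = n%:R `^ a * n%:R `^ b :> R.
Proof. by move=> n0; rewrite powRD// pnatr_neq0// implybT. Qed.

Lemma powO_ext b r r' :
  (forall n, (0 < n)%N -> r n = r' n) -> powO b r -> powO b r'.
Proof. by move=> rr' [C rC]; exists C => n n0; rewrite -rr'// rC. Qed.

Lemma powOD b r r' : powO b r -> powO b r' -> powO b (fun n => r n + r' n).
Proof.
move=> [C rC] [C' rC']; exists (C + C') => n n0.
by rewrite mulrDl (le_trans (ler_normD _ _))// lerD ?rC ?rC'.
Qed.

Lemma powOZ c b r : powO b r -> powO b (fun n => c * r n).
Proof.
move=> [C rC]; exists (`|c| * C) => n n0.
by rewrite normrM -mulrA ler_wpM2l// rC.
Qed.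

Lemma powO_le b b' r : b <= b' -> powO b r -> powO b' r.
Proof.
move=> bb' [C rC]; exists C => n n0; apply: le_trans (rC n n0) _.
have C0 : 0 <= C.
  by have := rC 1%N isT; rewrite powR1 mulr1; apply: le_trans.
by rewrite ler_wpM2l// ler_powR// pnatr_ge1.
Qed.

Lemma powO_powR b : powO b (fun n => n%:R `^ b).
Proof. by exists 1 => n n0; rewrite mul1r ger0_norm ?powR_ge0. Qed.

Lemma powOM b b' r r' :
  powO b r -> powO b' r' -> powO (b + b') (fun n => r n * r' n).
Proof.
move=> [C rC] [C' rC']; exists (C * C') => n n0.
by rewrite normrM powRDn// mulrACA ler_pM// ?rC ?rC'.
Qed.

(** A Poincare expansion along b, b - 1, b - 2, ..., where each truncation has an error of the order
    of the first omitted power. *)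
Definition pexp b d r : Prop := forall M,
  powO (b - M%:R) (fun n => r n - \sum_(i < M) d i * n%:R `^ (b - i%:R)).

Lemma pexp_ext b d r r' :
  (forall n, (0 < n)%N -> r n = r' n) -> pexp b d r -> pexp b d r'.
Proof.
by move=> rr' dr M; apply: powO_ext (dr M) => n n0; rewrite rr'.
Qed.

Lemma pexpD b d d' r r' : pexp b d r -> pexp b d' r' ->
  pexp b (fun i => d i + d' i) (fun n => r n + r' n).
Proof.
move=> dr dr' M; apply: powO_ext (powOD (dr M) (dr' M)) => n n0.
under [in RHS]eq_bigr do rewrite mulrDl.
by rewrite big_split /= opprD addrACA.
Qed.

Lemma pexpZ c b d r : pexp b d r ->
  pexp b (fun i => c * d i) (fun n => c * r n).
Proof.
move=> dr M; apply: powO_ext (powOZ c (dr M)) => n n0.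
by rewrite mulrBr mulr_sumr; under eq_bigr do rewrite mulrA.
Qed.

Lemma pexpB b d d' r r' : pexp b d r -> pexp b d' r' ->
  pexp b (fun i => d i - d' i) (fun n => r n - r' n).
Proof.
move=> dr /(pexpZ (-1)) /(pexpD dr); under eq_fun do rewrite mulN1r.
by under [X in pexp _ _ X]eq_fun do rewrite mulN1r.
Qed.

Lemma pexp_lower b d r : d 0%N = 0 -> pexp b d r ->
  pexp (b - 1) (fun i => d i.+1) r.
Proof.
move=> d0 dr M.
have -> : b - 1 - M%:R = b - M.+1%:R by rewrite -natr1; lra.
apply: powO_ext (dr M.+1) => n n0.
rewrite big_ord_recl /= d0 mul0r add0r; congr (_ - _); apply: eq_bigr => i _.
by congr (_ * _ `^ _); rewrite /bump /= natrD opprD addrA.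
Qed.

(** Padding by a zero leading coefficient lets expansions whose top exponents differ by an integer
    be added. *)
Lemma pexp_raise b d r : pexp b d r ->
  pexp (b + 1) (fun i => if i is j.+1 then d j else 0) r.
Proof.
move=> dr [|M].
  apply: (@powO_ext _ r) => [n _|]; first by rewrite big_ord0 subr0.
  apply: (@powO_le b); first by rewrite subr0; lra.
  by have := dr 0%N; rewrite subr0; apply: powO_ext => n _; rewrite big_ord0 subr0.
have -> : b + 1 - M.+1%:R = b - M%:R by rewrite -natr1; lra.
apply: powO_ext (dr M) => n n0.
rewrite big_ord_recl /= mul0r add0r; congr (_ - _); apply: eq_bigr => i _.
by congr (_ * _ `^ _); rewrite /bump /= natrD; lra.
Qed.

Lemma pexp_powM a b d r : pexp b d r ->
  pexp (a + b) d (fun n => n%:R `^ a * r n).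
Proof.
move=> dr M; rewrite -addrA.
apply: powO_ext (powOM (powO_powR a) (dr M)) => n n0.
rewrite mulrBr mulr_sumr; congr (_ - _); apply: eq_bigr => i _.
by rewrite -addrA (powRDn a)// mulrCA.
Qed.

Lemma pexp_powR b : pexp b (fun i => (i == 0%N)%:R) (fun n => n%:R `^ b).
Proof.
move=> [|M].
  by apply: powO_ext (powO_powR _) => n n0; rewrite big_ord0 !subr0.
exists 0 => n n0; rewrite big_ord_recl /= mul1r subr0 big1 ?addr0.
  by rewrite subrr normr0 mul0r.
by move=> i _; rewrite mul0r.
Qed.

(** Omitted terms can be moved into the error one at a time, so short truncations follow from long
    ones by descending induction. *)
Lemma pexp_large b d r :
  (exists M0, forall M, (M0 <= M)%N ->
    powO (b - M%:R) (fun n => r n - \sum_(i < M) d i * n%:R `^ (b - i%:R))) ->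
  pexp b d r.
Proof.
move=> [M0 H] M; have [k kM] := ubnP (M0 - M); elim: k M kM => // k IH M kM.
have [/H//|MM0] := leqP M0 M.
have H1 : powO (b - M%:R)
    (fun n => r n - \sum_(i < M.+1) d i * n%:R `^ (b - i%:R)).
  by apply: powO_le (IH M.+1 _); [rewrite -natr1; lra|lia].
apply: powO_ext (powOD H1 (powOZ (d M) (powO_powR (b - M%:R)))) => n n0.
by rewrite big_ord_recr /= opprD addrA addrNK.
Qed.

Lemma powR_opp_nat n i : (0 < n)%N -> n%:R `^ (- i%:R) = n%:R^-1 ^+ i :> R.
Proof. by move=> n0; rewrite powR_invn// exprVn. Qed.

Lemma natr_inv01 n : (0 < n)%N -> 0 <= (n%:R^-1 : R) <= 1.
Proof. by move=> n0; rewrite invr_ge0 ler0n /= invf_le1 ?pnatr_ge1 ?pnatr_gt0. Qed.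

Lemma pexp_powR1D b : pexp 0 (gbinom b) (fun n => (1 + n%:R^-1) `^ b).
Proof.
move=> M; have [C CP] := powR1D_taylor b M; exists C => n n0.
rewrite sub0r powR_opp_nat//; under eq_bigr do rewrite sub0r powR_opp_nat//.
by apply: CP; exact: natr_inv01.
Qed.

Lemma pexp_ln1D : pexp 0 (@ln1D_coef R) (fun n => ln (1 + n%:R^-1)).
Proof.
apply: pexp_large; exists 1%N => -[//|M] _.
have [C CP] := @ln1D_taylor R M; exists C => n n0.
rewrite sub0r powR_opp_nat//; under eq_bigr do rewrite sub0r powR_opp_nat//.
by apply: CP; exact: natr_inv01.
Qed.

Lemma ln_succ n : (0 < n)%N -> ln n.+1%:R = ln n%:R + ln (1 + n%:R^-1) :> R.
Proof.
move=> n0; have n0' := pnatr_gt0 n0.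
rewrite -lnM ?posrE ?ltr_wpDr// ?invr_ge0//.
by rewrite mulrDr mulr1 divff ?pnatr_neq0// natr1.
Qed.

Lemma powR_succ n b : (0 < n)%N ->
  n.+1%:R `^ b = n%:R `^ b * (1 + n%:R^-1) `^ b :> R.
Proof.
move=> n0; have n0' := pnatr_gt0 n0.
rewrite -powRM ?ltW// ?ltr_wpDr ?invr_ge0//.
by rewrite mulrDr mulr1 divff ?pnatr_neq0// natr1.
Qed.

(* The recurrence reads [bst_diff T = 2 t] for [T n = f n - t n]; the kernel of
   [bst_diff] on positive indices is spanned by [n + 1], and [bst_diff] maps
   [n^b] to [(b - 1) n^b] plus lower order terms. *)
Definition bst_diff u n : R := n.+1%:R * u n.+1 - n.+2%:R * u n.

Lemma bst_diffD u w n :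
  bst_diff (fun n => u n + w n) n = bst_diff u n + bst_diff w n.
Proof. by rewrite /bst_diff; ring. Qed.

Lemma bst_diffZ c u n : bst_diff (fun n => c * u n) n = c * bst_diff u n.
Proof. by rewrite /bst_diff; ring. Qed.

Lemma bst_diffB u w n :
  bst_diff (fun n => u n - w n) n = bst_diff u n - bst_diff w n.
Proof. by rewrite /bst_diff; ring. Qed.

(** Here [bst_diff] sends n^b to (n + 1)^(b+1) - n^(b+1) - 2 n^b. The powers n^(b+1) cancel, which
    shifts the binomial index by one, and the 2 affects the top coefficient only. *)
Definition bst_diff_coef b i : R :=
  gbinom (b + 1) i.+1 - (if i == 0%N then 2 else 0).

Lemma pexp_bst_diff_powR b :
  pexp b (bst_diff_coef b) (bst_diff (fun n => n%:R `^ b)).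
Proof.
have H1 : pexp (b + 1) (gbinom (b + 1)) (fun n => n.+1%:R `^ (b + 1)).
  have := pexp_powM (b + 1) (pexp_powR1D (b + 1)); rewrite addr0.
  by apply: pexp_ext => n n0; rewrite powR_succ.
have := pexp_lower _ (pexpB (pexpB H1 (pexp_powR (b + 1)))
  (pexp_raise (pexpZ 2 (pexp_powR b)))).
rewrite addrK /= !subr0 subrr => /(_ erefl) H.
have -> : bst_diff_coef b = fun i => gbinom (b + 1) i.+1 - 0 - 2 * (i == 0%N)%:R.
  by apply/funext => i; rewrite /bst_diff_coef subr0; case: eqP => _; rewrite ?mulr1 ?mulr0.
apply: pexp_ext H => n n0.
rewrite /bst_diff !powRDn// !powRr1// -!natr1; ring.
Qed.

Lemma bst_diff_coef0 b : bst_diff_coef b 0 = b - 1.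
Proof. by rewrite /bst_diff_coef /=; lra. Qed.

End power_bounds.

(** * From bounds on differences to bounds on sequences, and the inversion of [bst_diff] *)

Section summation.
Context {R : realType}.
Implicit Types (b x C s K : R) (M i n : nat) (d r u w : nat -> R).

(** Mean value theorem for (1 + y)^s on [0, 1/n]. Keeping the factor [s] apart from the positive
    quantity [z] makes one statement serve both signs of [s]. *)
Lemma powR_diff_ge s : exists2 c : R, 0 < c & forall n, (0 < n)%N ->
  exists2 z : R, c * n%:R `^ (s - 1) <= z & n.+1%:R `^ s - n%:R `^ s = s * z.
Proof.
exists (2 `^ (- `|s - 1|)) => [|n n0]; first by rewrite powR_gt0.
have /andP[x0 x1] := @natr_inv01 R _ n0.
have [|| c] := @MVT_segment R (fun y => (1 + y) `^ s)
  (fun y => s * (1 + y) `^ (s - 1)) 0 n%:R^-1 x0.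
- move=> y; rewrite in_itv /= => /andP[y0 _]; apply: is_derive_powR1D; exact: ltW.
- apply: derivable_within_continuous => y; rewrite in_itv /= => /andP[y0 _].
  by have [] := is_derive_powR1D s y0.
rewrite in_itv /= => /andP[c0 cx]; rewrite addr0 powR1 subr0 => E.
exists (n%:R `^ (s - 1) * (1 + c) `^ (s - 1)); last first.
  rewrite powR_succ// -[X in _ - X]mulr1 -mulrBr E.
  rewrite (_ : n%:R `^ s = n%:R `^ (s - 1) * n%:R); last first.
    by rewrite -[in LHS](subrK 1 s) (powRDn (s - 1) 1)// powRr1.
  by have := @pnatr_neq0 R _ n0 => ?; field.
rewrite mulrC ler_wpM2l ?powR_ge0//.
apply: (@le_trans _ _ ((1 + c) `^ (- `|s - 1|))); last first.
  by rewrite ler_powR ?lerDl// lerNl ler_normr lexx orbT.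
rewrite !powRN lef_pV2 ?posrE ?powR_gt0 ?ltr_wpDr//.
by rewrite ge0_ler_powR ?nnegrE ?addr_ge0//; lra.
Qed.

(* [w - y] increases, [w + y] decreases and [y n] is a multiple of [n^-s]: the
   limit is the supremum of [w - y]. *)
Lemma powO_diff_cvg s w : 0 < s ->
  powO (- s - 1) (fun n => w n.+1 - w n) -> exists K, powO (- s) (fun n => w n - K).
Proof.
move=> s0 [C wC].
have C0 : 0 <= C by have := wC 1%N isT; rewrite powR1 mulr1; apply: le_trans.
have [c c0 cP] := powR_diff_ge (- s).
(* This [Y] makes the decrease y(n) - y(n + 1) at least C n^(-s-1), the bound on the increments of
   [w]. *)
pose Y := C / (c * s); pose y n : R := Y * n%:R `^ (- s).
have y0 n : 0 <= y n.
  by rewrite mulr_ge0 ?powR_ge0// divr_ge0// ltW// mulr_gt0.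
have wy n : (0 < n)%N -> `|w n.+1 - w n| <= y n - y n.+1.
  move=> n0; apply: le_trans (wC n n0) _; have [z zP E] := cP n n0.
  rewrite /y -mulrBr -[X in _ <= _ * X]opprB E mulNr opprK /Y.
  rewrite (_ : C / (c * s) * (s * z) = C / c * z); last first.
    by field; rewrite !gt_eqF.
  by rewrite -mulrA ler_wpM2l// ler_pdivlMl.
have inc : {homo (fun n => w n.+1 - y n.+1) : m n / (m <= n)%N >-> m <= n}.
  apply: homo_leq => [x|x1 x2 x3|n]; [exact: lexx|exact: le_trans|].
  by have := wy n.+1 isT; rewrite ler_norml => /andP[H1 H2]; lra.
have dec : {homo (fun n => w n.+1 + y n.+1) : m n / (m <= n)%N >-> n <= m}.
  apply: (homo_leq (r := fun a b : R => b <= a)) => [x|x1 x2 x3 H1 H2|n];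
    [exact: lexx|exact: le_trans H2 H1|].
  by have := wy n.+1 isT; rewrite ler_norml => /andP[H1 H2]; lra.
(* Both sides are compared through the index max(m, n), using the two monotonicities and y >= 0. *)
have cross m n : w m.+1 - y m.+1 <= w n.+1 + y n.+1.
  apply: le_trans (inc m _ (leq_maxl m n)) _.
  apply: le_trans (dec n _ (leq_maxr m n)).
  by have := y0 (maxn m n).+1; lra.
pose S := [set w n.+1 - y n.+1 | n in [set: nat]].
have Sub n : ubound S (w n.+1 + y n.+1) by move=> _ [m _ <-].
exists (sup S), Y => -[//|n] _; rewrite -/(y n.+1) ler_distl.
have H1 : sup S <= w n.+1 + y n.+1.
  by apply: ge_sup; [exists (w 1%N - y 1%N), 0%N|exact: Sub].
have H2 : w n.+1 - y n.+1 <= sup S.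
  apply: ub_le_sup; [exists (w 1%N + y 1%N); exact: Sub|by exists n].
by apply/andP; split; lra.
Qed.

(** The increments of [w] are dominated by those of Y n^s, which telescope; the starting value
    |w(1)| is absorbed because n^s >= 1. *)
Lemma powO_diff_growth s w : 0 < s ->
  powO (s - 1) (fun n => w n.+1 - w n) -> powO s w.
Proof.
move=> s0 [C wC].
have C0 : 0 <= C by have := wC 1%N isT; rewrite powR1 mulr1; apply: le_trans.
have [c c0 cP] := powR_diff_ge s.
pose Y := C / (c * s); have Y0 : 0 <= Y by rewrite divr_ge0// ltW// mulr_gt0.
have wy n : (0 < n)%N ->
    `|w n.+1 - w n| <= Y * n.+1%:R `^ s - Y * n%:R `^ s.
  move=> n0; apply: le_trans (wC n n0) _; have [z zP E] := cP n n0.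
  rewrite -mulrBr E /Y.
  rewrite (_ : C / (c * s) * (s * z) = C / c * z); last first.
    by field; rewrite !gt_eqF.
  by rewrite -mulrA ler_wpM2l// ler_pdivlMl.
have H n : `|w n.+1| <= `|w 1%N| + Y * n.+1%:R `^ s.
  elim: n => [|n IH].
    by rewrite lerDl powR1 mulr1.
  rewrite -[w n.+2](subrK (w n.+1)); apply: le_trans (ler_normD _ _) _.
  by have := wy n.+1 isT; lra.
exists (`|w 1%N| + Y) => -[//|n] _; apply: le_trans (H n) _.
rewrite mulrDl lerD2r ler_peMr//.
by rewrite -[leLHS](powRr0 n.+1%:R) ler_powR ?pnatr_ge1// ltW.
Qed.

Lemma powR_opp_small s e : 0 < s -> 0 < e ->
  \forall n \near \oo, n%:R `^ (- s) <= e :> R.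
Proof.
move=> s0 e0; near=> n.
have n0 : 0 < n%:R :> R by rewrite ltr0n; near: n; exact: nbhs_infty_gt.
rewrite powRN -[leRHS]invrK lef_pV2 ?posrE ?powR_gt0 ?invr_gt0//.
rewrite (_ : e^-1 = (e `^ (- s^-1)) `^ s); last first.
  by rewrite -powRrM mulNr mulVf ?gt_eqF// powR_inv1// ltW.
rewrite ge0_ler_powR ?nnegrE ?powR_ge0 ?ltW//.
by near: n; exact: nbhs_infty_gtr.
Unshelve. all: by end_near. Qed.

Lemma powO_cvg0 b r : b < 0 -> powO b r -> r @ \oo --> (0 : R).
Proof.
move=> b0 [C rC]; apply/cvgrPdist_le => e e0.
have C0 : 0 <= C by have := rC 1%N isT; rewrite powR1 mulr1; apply: le_trans.
near=> n; rewrite sub0r normrN.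
have n0 : (0 < n)%N by near: n; exact: nbhs_infty_gt.
apply: le_trans (rC n n0) _.
have nb : n%:R `^ b <= e / (C + 1).
  near: n; rewrite -[b]opprK; apply: powR_opp_small; first by rewrite oppr_gt0.
  by rewrite divr_gt0// ltr_wpDl.
apply: le_trans (ler_wpM2l C0 nb) _.
rewrite mulrCA ger_pMr// ler_pdivrMr ?ltr_wpDl//; lra.
Unshelve. all: by end_near. Qed.

Lemma powO_inv_succ : powO (-1) (fun n => (n%:R + 1)^-1 : R).
Proof.
exists 1 => n n0; have n0' := @pnatr_gt0 R _ n0.
have n1 : 0 < n%:R + 1 :> R by lra.
by rewrite mul1r powR_inv1// gtr0_norm ?invr_gt0// lef_pV2 ?posrE//; lra.
Qed.

Lemma powO_inv_succ2 : powO (-1) (fun n => (n%:R + 2)^-1 : R).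
Proof.
exists 1 => n n0; have n0' := @pnatr_gt0 R _ n0.
have n1 : 0 < n%:R + 2 :> R by lra.
by rewrite mul1r powR_inv1// gtr0_norm ?invr_gt0// lef_pV2 ?posrE//; lra.
Qed.

Lemma powO_succ : powO 1 (fun n => n%:R + 1 : R).
Proof.
exists 2 => n n0; have n1 := @pnatr_ge1 R _ n0.
by rewrite powRr1 ?ger0_norm ?addr_ge0//; lra.
Qed.

Lemma bst_diff_quot u n :
  u n.+1 / (n.+1%:R + 1) - u n / (n%:R + 1) =
  bst_diff u n * ((n%:R + 1)^-1 * (n%:R + 2)^-1).
Proof.
have n1 : n%:R + 1 != 0 :> R by rewrite gt_eqF// ltr_wpDl.
have n2 : n%:R + 2 != 0 :> R by rewrite gt_eqF// ltr_wpDl.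
have n3 : n%:R + 1 + 1 != 0 :> R by rewrite gt_eqF// ltr_wpDl.
by rewrite /bst_diff -!natr1; field; rewrite ?n1 ?n2 ?n3.
Qed.

Lemma powO_bst_diff_quot b u : powO b (bst_diff u) ->
  powO (b - 2) (fun n => u n.+1 / (n.+1%:R + 1) - u n / (n%:R + 1)).
Proof.
move=> /powOM /(_ (powOM powO_inv_succ powO_inv_succ2)).
rewrite (_ : -1 + -1 = - 2); last by lra.
by apply: powO_ext => n n0; rewrite bst_diff_quot.
Qed.

Lemma natr_succ_neq0 n : n%:R + 1 != 0 :> R.
Proof. by rewrite gt_eqF// ltr_wpDl. Qed.

(** The increments of u(n)/(n + 1) are O(n^(b-2)), hence summable with tail O(n^(b-1)). Their limit
    is [K], and multiplying by n + 1 restores the exponent [b]. *)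
Lemma powO_bst_diff_lt1 b u : b < 1 -> powO b (bst_diff u) ->
  exists K, powO b (fun n => u n - K * (n%:R + 1)).
Proof.
move=> b1 /powO_bst_diff_quot H.
have [||K KP] := @powO_diff_cvg (1 - b) (fun n => u n / (n%:R + 1)).
- by rewrite subr_gt0.
- by rewrite (_ : - (1 - b) - 1 = b - 2)//; lra.
exists K; have := powOM KP powO_succ.
rewrite (_ : - (1 - b) + 1 = b); last by lra.
by apply: powO_ext => n n0; rewrite mulrBl divfK// natr_succ_neq0.
Qed.

(** No constant appears, since the kernel element n + 1 is itself O(n^b). *)
Lemma powO_bst_diff_gt1 b u : 1 < b -> powO b (bst_diff u) -> powO b u.
Proof.
move=> b1 /powO_bst_diff_quot H.
have := @powO_diff_growth (b - 1) (fun n => u n / (n%:R + 1)).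
rewrite subr_gt0 (_ : b - 1 - 1 = b - 2); last by lra.
move=> /(_ b1 H) /powOM /(_ powO_succ); rewrite subrK.
by apply: powO_ext => n n0; rewrite divfK ?natr_succ_neq0.
Qed.

(** This gives uniqueness of the kernel constant: n + 1 is not O(n^b) below exponent 1. *)
Lemma powO_succ_eq0 b K : b < 1 -> powO b (fun n => K * (n%:R + 1)) -> K = 0.
Proof.
move=> b1 /powOM /(_ powO_inv_succ) H.
have : powO (b + -1) (fun=> K).
  by apply: powO_ext H => n n0; rewrite mulfK// natr_succ_neq0.
move/powO_cvg0 => /(_ _) H0.
have H1 : (fun=> K) @ \oo --> (0 : R) by apply: H0; lra.
have H2 : (fun=> K) @ \oo --> K by exact: cvg_cst.
exact: (cvg_unique _ H2 H1).
Qed.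

(* Meaningful only up to the first [k] with [b - k = 1]: there the division by
   [b - k - 1] takes its junk value. *)
Fixpoint residual_coef b d k : nat -> R :=
  if k is j.+1 then
    fun i => residual_coef b d j i.+1 -
      residual_coef b d j 0 / (b - j%:R - 1) * bst_diff_coef (b - j%:R) i.+1
  else d.

Definition solution_coef b d k : R := residual_coef b d k 0 / (b - k%:R - 1).

(** Each step subtracts the multiple of n^(b-k) whose image has the same leading term as the
    residual. The image has leading coefficient b - k - 1, which the hypothesis keeps nonzero. *)
Lemma pexp_residual b d u k : (forall i, (i < k)%N -> b - i%:R != 1) ->
  pexp b d (bst_diff u) ->
  pexp (b - k%:R) (residual_coef b d k) (bst_diff
    (fun n => u n - \sum_(i < k) solution_coef b d i * n%:R `^ (b - i%:R))).
Proof.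
move=> + H; elim: k => [_|k IH kb].
  rewrite subr0; apply: pexp_ext H => n n0.
  by rewrite /bst_diff !big_ord0 !subr0.
have {}IH := IH (fun i ik => kb i (ltnW ik)).
have := pexp_lower _ (pexpB IH (pexpZ (solution_coef b d k)
  (pexp_bst_diff_powR (b - k%:R)))).
rewrite bst_diff_coef0 /solution_coef divfK ?subrr; last first.
  by rewrite subr_eq0 kb.
move=> /(_ erefl) H1.
rewrite (_ : b - k.+1%:R = b - k%:R - 1); last by rewrite -natr1; lra.
apply: pexp_ext H1 => n n0.
by rewrite /bst_diff !big_ord_recr /=; ring.
Qed.

Lemma bst_diff_solve b d u : (forall i, b - i%:R != 1) ->
  pexp b d (bst_diff u) ->
  exists K c, pexp b c (fun n => u n - K * (n%:R + 1)).
Proof.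
move=> bi H; pose c := solution_coef b d.
pose v M n := u n - \sum_(i < M) c i * n%:R `^ (b - i%:R).
have vO M : powO (b - M%:R) (bst_diff (v M)).
  have := pexp_residual (fun i (_ : (i < M)%N) => bi i) H 0%N; rewrite subr0.
  by apply: powO_ext => n n0; rewrite big_ord0 subr0.
have [M0 M0b] : exists M0, b - M0%:R < 1.
  exists (Num.bound `|b|); have := archi_boundP (normr_ge0 b).
  by have := ler_norm b; lra.
have step M : b - M%:R < 1 -> exists K, powO (b - M%:R) (fun n => v M n - K * (n%:R + 1)).
  by move=> Mb; exact: powO_bst_diff_lt1 (vO M).
(* The constant is read off at one length [M0] beyond the exponent 1; the induction below shows that
   longer truncations give the same one. *)
have [K KP] := step _ M0b; exists K, c; apply: pexp_large; exists M0 => M M0M.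
suff : powO (b - M%:R) (fun n => v M n - K * (n%:R + 1)).
  by apply: powO_ext => n n0; rewrite /v addrAC.
rewrite -(subnKC M0M); elim: (M - M0)%N => [|k IH]; first by rewrite addn0.
rewrite addnS; set m := (M0 + k)%N in IH *.
have mb : b - m.+1%:R < b - m%:R by rewrite -natr1; lra.
have mb1 : b - m%:R < 1 by rewrite /m natrD; have := ler0n R k; lra.
have [K' K'P] := step m.+1 (lt_trans mb mb1).
(* Consecutive remainders differ by c(m) n^(b-m), so (K - K')(n + 1) = O(n^(b-m)) with b - m < 1. *)
suff -> : K = K' by [].
apply/eqP; rewrite -subr_eq0; apply/eqP; apply: (powO_succ_eq0 mb1).
have := powOD (powO_le (ltW mb) K'P)
  (powOD (powOZ (-1) IH) (powOZ (c m) (powO_powR (b - m%:R)))).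
by apply: powO_ext => n n0; rewrite /v big_ord_recr /=; ring.
Qed.

End summation.

(** * The descending scale of powers and logarithms *)

Section scale.
Context {R : realType}.
Implicit Types (b x y s K : R) (M N i j n : nat) (d r f g : nat -> R).

(** The epsilon form to which [eqaddoP] reduces a little-o. *)
Definition negligible r g : Prop := forall eps : R, 0 < eps ->
  \forall n \near \oo, `|r n| <= eps * `|g n|.

Lemma negligibleD r r' g : negligible r g -> negligible r' g ->
  negligible (fun n => r n + r' n) g.
Proof.
move=> H H' eps eps0; have e2 : 0 < eps / 2 by rewrite divr_gt0.
near=> n; apply: le_trans (ler_normD _ _) _; rewrite (splitr eps) mulrDl.
by apply: lerD; near: n; [exact: H|exact: H'].
Unshelve. all: by end_near. Qed.

Lemma negligible_bound C r r' g : (forall n, (0 < n)%N -> `|r' n| <= C * `|r n|) ->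
  negligible r g -> negligible r' g.
Proof.
move=> rC H eps eps0.
have C1 : 0 < `|C| + 1 by rewrite ltr_wpDl.
near=> n.
have n0 : (0 < n)%N by near: n; exact: nbhs_infty_gt.
have : `|r n| <= eps / (`|C| + 1) * `|g n|.
  by near: n; apply: H; rewrite divr_gt0.
have : `|r' n| <= (`|C| + 1) * `|r n|.
  apply: le_trans (rC n n0) _; rewrite ler_wpM2r//.
  by apply: le_trans (ler_norm C) _; rewrite lerDl.
move=> H1 H2; apply: le_trans H1 _; rewrite mulrC -ler_pdivlMr//.
by rewrite mulrAC.
Unshelve. all: by end_near. Qed.

Lemma ln_natr_ge0 n : (0 < n)%N -> 0 <= ln n%:R :> R.
Proof. by move=> n0; rewrite ln_ge0// pnatr_ge1. Qed.

Lemma powR_negligible a a' eps : a' < a -> 0 < eps ->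
  \forall n \near \oo, n%:R `^ a' <= eps * n%:R `^ a :> R.
Proof.
move=> aa' e0; near=> n.
have n0 : (0 < n)%N by near: n; exact: nbhs_infty_gt.
rewrite (_ : a' = a + - (a - a')); last by lra.
rewrite powRDn// mulrC ler_wpM2r ?powR_ge0//.
by near: n; apply: powR_opp_small; rewrite ?subr_gt0.
Unshelve. all: by end_near. Qed.

Lemma ln_le_powR s n : 0 < s -> (0 < n)%N -> ln n%:R <= s^-1 * n%:R `^ s :> R.
Proof.
move=> s0 n0; rewrite ler_pdivlMl// -ln_powR ltW// ln_sublinear//.
by rewrite powR_gt0// pnatr_gt0.
Qed.

Lemma ln_negligible s eps : 0 < s -> 0 < eps ->
  \forall n \near \oo, ln n%:R <= eps * n%:R `^ s :> R.
Proof.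
move=> s0 e0; have s2 : 0 < s / 2 by rewrite divr_gt0.
near=> n.
have n0 : (0 < n)%N by near: n; exact: nbhs_infty_gt.
apply: le_trans (ln_le_powR s2 n0) _; rewrite ler_pdivrMl// mulrA.
by near: n; apply: powR_negligible; [lra|exact: mulr_gt0].
Unshelve. all: by end_near. Qed.

Lemma ln_large (A : R) : \forall n \near \oo, A <= ln n%:R.
Proof.
near=> n.
have n0 : (0 < n)%N by near: n; exact: nbhs_infty_gt.
rewrite -[A]expRK ler_ln ?posrE ?expR_gt0 ?pnatr_gt0//.
by near: n; exact: nbhs_infty_ger.
Unshelve. all: by end_near. Qed.

(** Only the logarithmic exponents 0 and 1 are needed, so they are encoded as booleans and four
    comparisons suffice. *)
Lemma power_log_negligible (a a' : R) (m m' : bool) :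
  a' < a \/ (a' = a /\ (m' < m)%N) ->
  negligible (power_log a' m') (power_log a m).
Proof.
move=> H eps e0.
suff : \forall n \near \oo,
    n%:R `^ a' * ln n%:R ^+ m' <= eps * (n%:R `^ a * ln n%:R ^+ m) :> R.
  move=> H'; near=> n.
  have n0 : (0 < n)%N by near: n; exact: nbhs_infty_gt.
  rewrite /power_log !ger0_norm ?mulr_ge0 ?exprz_ge0 ?powR_ge0 ?ln_natr_ge0//.
  by near: n.
case: m m' H => [] [] /= H.
- case: H => [H|[] //]; near=> n.
  have n0 : (0 < n)%N by near: n; exact: nbhs_infty_gt.
  rewrite mulrA ler_wpM2r ?ln_natr_ge0//.
  by near: n; exact: powR_negligible.
- have aa' : a' <= a by case: H => [/ltW//|[-> _]].
  near=> n.
  have n0 : (0 < n)%N by near: n; exact: nbhs_infty_gt.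
  rewrite expr0 mulr1; apply: le_trans (ler_powR (pnatr_ge1 n0) aa') _.
  rewrite mulrCA -[leLHS]mulr1 ler_wpM2l ?powR_ge0// -ler_pdivrMl// mulr1.
  by near: n; exact: ln_large.
- case: H => [H|[] //]; near=> n.
  have n0 : (0 < n)%N by near: n; exact: nbhs_infty_gt.
  rewrite expr0 mulr1 (_ : a = a' + (a - a')); last by lra.
  rewrite powRDn// mulrCA ler_wpM2l ?powR_ge0//.
  by near: n; apply: ln_negligible; rewrite ?subr_gt0.
- case: H => [H|[] //]; near=> n; rewrite !expr0 !mulr1.
  by near: n; exact: powR_negligible.
Unshelve. all: by end_near. Qed.

(** Two sequences are interleaved: N, N - 1, ... at even indices, carrying a logarithm when [e]
    holds, and b, b - 1, ... at odd indices without one. They descend when N - 1 < b < N, and also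
    when b = N provided the logarithm breaks the tie. *)
Definition scale_exp N b j : R := (if odd j then b else N%:R) - j./2%:R.

Definition scale_log (e : bool) j : int := (~~ odd j && e : bool).

Definition scale_coef (p q : nat -> R) j : R := if odd j then q j./2 else p j./2.

Section properties.
Variables (N : nat) (b : R) (e : bool).
Hypotheses (Nb : N%:R - 1 < b) (bN : b < N%:R \/ (b = N%:R /\ e)).

Let step_odd_even j :
  scale_exp N b j.+1 < scale_exp N b j \/
  (scale_exp N b j.+1 = scale_exp N b j /\
    ((~~ odd j.+1 && e : bool) < (~~ odd j && e : bool))%N).
Proof.
rewrite /scale_exp /= uphalf_half; case: (odd j) => /=.
  by left; rewrite natrD mulr1n opprD addrA ltrD2r.
by rewrite [(false + _)%N]add0n; case: bN => [H|[-> ->]]; [left; rewrite ltrD2r|right].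
Qed.

Lemma scale_step j : scale_exp N b j.+1 < scale_exp N b j \/
  (scale_exp N b j.+1 = scale_exp N b j /\ scale_log e j.+1 < scale_log e j).
Proof. exact: step_odd_even. Qed.

Lemma scale_cvg : scale_exp N b @ \oo --> -oo.
Proof.
apply/cvgrNyPle => A.
have bN' : b <= N%:R by case: bN => [/ltW//|[->]].
near=> j; apply: (@le_trans _ _ (N%:R - j./2%:R)).
  by rewrite /scale_exp; case: odd; rewrite lerB.
rewrite lerBlDr -lerBlDl.
apply: le_trans (ler_norm _) _; apply: ltW.
apply: lt_le_trans (archi_boundP (normr_ge0 (N%:R - A))) _.
rewrite ler_nat geq_half_double; near: j; exact: nbhs_infty_ge.
Unshelve. all: by end_near. Qed.

Lemma scale_negligible i j : (i < j)%N ->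
  negligible (power_log (scale_exp N b j) (scale_log e j))
             (power_log (scale_exp N b i) (scale_log e i)).
Proof.
move=> ij; rewrite -(subnKC ij); elim: (j - i.+1)%N => [|k IH].
  by rewrite addn0; apply: power_log_negligible; exact: step_odd_even.
rewrite addnS => eps e0; near=> n.
apply: (@le_trans _ _ (1 * `|power_log (scale_exp N b (i.+1 + k))
  (scale_log e (i.+1 + k)) n|)).
  near: n; apply: power_log_negligible => //; exact: step_odd_even.
by rewrite mul1r; near: n; exact: IH.
Unshelve. all: by end_near. Qed.

Lemma power_log_scale_odd M n :
  power_log (scale_exp N b M.*2.+1) (scale_log e M.*2.+1) n = n%:R `^ (b - M%:R).
Proof.
rewrite /power_log /scale_exp /scale_log /= odd_double /= expr0z mulr1.
by rewrite uphalf_double.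
Qed.

Lemma scale_sum (p q : nat -> R) M n :
  \sum_(0 <= j < M.*2) scale_coef p q j * power_log (scale_exp N b j) (scale_log e j) n
  = \sum_(i < M) p i * n%:R `^ (N%:R - i%:R) * ln n%:R ^+ e
    + \sum_(i < M) q i * n%:R `^ (b - i%:R).
Proof.
elim: M => [|M IH]; first by rewrite big_geq// !big_ord0 addr0.
rewrite doubleS !big_nat_recr//= !big_ord_recr /= IH.
rewrite /scale_coef /scale_exp /scale_log /power_log /= odd_double /=.
rewrite uphalf_double doubleK expr0z mulr1 !addrA [in RHS]addrAC -!addrA.
by case: e => //=; rewrite ?expr1z ?expr0z ?expr1 ?expr0 !mulrA; congr (_ + _); ring.
Qed.

End properties.

(** With top exponent N + 1, the exponents 1 and 0 sit at positions N and N + 1; a linear polynomial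
    is thus exact once both are included. *)
Lemma linear_scale_sum N x y k n : (0 < n)%N ->
  \sum_(i < N.+2 + k) (if i == N :> nat then x else if i == N.+1 :> nat then y else 0)
     * n%:R `^ (N.+1%:R - i%:R) = x * n%:R + y :> R.
Proof.
move=> n0; elim: k => [|k IH].
  rewrite addn0 !big_ord_recr /= big1 => [|i _]; last first.
    by rewrite !ltn_eqF ?mul0r// ?ltn_ord// ltnS ltnW.
  rewrite !eqxx add0r subrr powRr0 mulr1 gtn_eqF//.
  by rewrite -natr1 addrAC subrr add0r powRr1.
by rewrite addnS big_ord_recr /= IH !gtn_eqF ?mul0r ?addr0//; lia.
Qed.

Lemma full_expansion_of_pexp N b (e : bool) x y d f :
  N.+1%:R - 1 < b -> b < N.+1%:R \/ (b = N.+1%:R /\ e) ->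
  pexp b d (fun n => f n - (x * n%:R + y) * ln n%:R ^+ e) ->
  full_power_log_expansion f.
Proof.
move=> Nb bN H.
pose p i := if i == N then x else if i == N.+1 then y else 0.
pose g j := power_log (scale_exp N.+1 b j) (scale_log e j).
exists (scale_exp N.+1 b), (scale_log e), (scale_coef p d); split.
- exact: scale_step.
- exact: scale_cvg bN.
move=> J; apply/eqaddoP; rewrite -/(negligible _ _).
(* This length contains both terms of the linear factor and also reaches past the index [J]. *)
set M := (N.+2 + J)%N; have [C CP] := H M.
have JM : (J.+1 <= M.*2)%N by rewrite /M; lia.
(* The error O(n^(b-M)) is the scale element of index 2M + 1, which lies beyond [J]. *)
have rem : negligible (fun n => f n - \sum_(0 <= j < M.*2) scale_coef p d j * g j n) (g J).
  apply: (@negligible_bound C (g M.*2.+1)); last by apply: scale_negligible => //; lia.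
  move=> n n0; have := CP n n0.
  rewrite /g scale_sum -mulr_suml linear_scale_sum// power_log_scale_odd.
  by rewrite [- (_ * _ + _)]opprD [f n + (_ - _)]addrA (ger0_norm (powR_ge0 _ _)).
(* The surplus terms strictly after [J] are each negligible as well, so the sum can be cut back to
   length J + 1. *)
have mid (K : nat) : negligible (fun n => \sum_(J.+1 <= j < J.+1 + K) scale_coef p d j * g j n) (g J).
  elim: K => [|K IH] eps e0.
    by near=> n; rewrite addn0 big_geq// normr0 mulr_ge0// ltW.
  have term : negligible (fun n => scale_coef p d (J.+1 + K) * g (J.+1 + K)%N n) (g J).
    apply: (@negligible_bound `|scale_coef p d (J.+1 + K)| (g (J.+1 + K)%N)).
      by move=> n _; rewrite normrM.
    by apply: scale_negligible => //; lia.
  have := negligibleD IH term e0; apply: filterS => n.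
  by rewrite addnS (@big_nat_recr _ _ _ (J.+1 + K)) ?leq_addr.
have := negligibleD rem (mid (M.*2 - J.+1)%N); rewrite subnKC// => H1 eps e0.
have := H1 eps e0; apply: filterS => n; apply: le_trans.
rewrite !fctE (big_cat_nat _ JM)//= opprD addrA subrK.
exact: lexx.
Unshelve. all: by end_near. Qed.

End scale.

(** * Existence of expansions, logarithms and harmonic numbers *)

Section expansions.
Context {R : realType}.
Implicit Types (b x y s K : R) (M N i j n : nat) (d r u w f g : nat -> R).

Definition has_pexp b r : Prop := exists d, pexp b d r.

Lemma has_pexpD b r r' : has_pexp b r -> has_pexp b r' ->
  has_pexp b (fun n => r n + r' n).
Proof. by move=> [d dr] [d' dr']; eexists; exact: pexpD dr dr'. Qed.

Lemma has_pexpZ c b r : has_pexp b r -> has_pexp b (fun n => c * r n).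
Proof. by move=> [d dr]; eexists; exact: pexpZ dr. Qed.

Lemma has_pexp_ext b r r' :
  (forall n, (0 < n)%N -> r n = r' n) -> has_pexp b r -> has_pexp b r'.
Proof. by move=> rr' [d dr]; exists d; exact: pexp_ext dr. Qed.

Lemma has_pexp_raise (k : nat) b b' r : b' = b + k%:R ->
  has_pexp b r -> has_pexp b' r.
Proof.
move=> ->; elim: k => [|k IH]; first by rewrite addr0.
by move=> /IH[d /pexp_raise]; rewrite -addrA natr1 => ?; eexists; eassumption.
Qed.

Lemma has_pexp_powR (k : nat) b b' : b' = b + k%:R ->
  has_pexp b' (fun n => n%:R `^ b).
Proof. by move/has_pexp_raise; apply; eexists; exact: pexp_powR. Qed.

Lemma has_pexp_sum b M (F : nat -> nat -> R) :
  (forall i, (i < M)%N -> has_pexp b (F i)) ->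
  has_pexp b (fun n => \sum_(i < M) F i n).
Proof.
elim: M => [_|M IH MF].
  exists (fun=> 0); move=> M; exists 0 => n _.
  by rewrite big_ord0 big1 ?subr0 ?normr0 ?mul0r// => i _; rewrite mul0r.
apply: (@has_pexp_ext _ (fun n => \sum_(i < M) F i n + F M n)).
  by move=> n _; rewrite big_ord_recr.
by apply: has_pexpD; [apply: IH => i iM; apply: MF; exact: ltnW|exact: MF].
Qed.

Lemma has_pexp_succ (k : nat) : has_pexp k.+1%:R (fun n => n%:R + 1 : R).
Proof.
have := has_pexpD (@has_pexp_powR k 1 k.+1%:R _) (@has_pexp_powR k.+1 0 k.+1%:R _).
rewrite -natr1 addrC add0r => /(_ erefl erefl).
by apply: has_pexp_ext => n n0; rewrite powRr1// powRr0.
Qed.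

Lemma pexp_ln1D_lower :
  pexp (-1) (fun i => @ln1D_coef R i.+1) (fun n => ln (1 + n%:R^-1)).
Proof. by have := pexp_lower erefl (@pexp_ln1D R); rewrite sub0r. Qed.

(** The image is (n^2 + 3n + 2) log (1 + 1/n), with leading term n. It supplies the exponent 1,
    where the image of the power n loses its leading term. *)
Lemma pexp_bst_diff_succ_ln : exists2 d, d 0%N = 1 &
  pexp 1 d (bst_diff (fun n => (n%:R + 1) * ln n%:R : R)).
Proof.
have L := pexp_ln1D_lower.
have L2 := pexp_powM 2 L; rewrite (_ : 2 + -1 = 1 :> R) in L2; last by lra.
have L1 := pexp_raise (pexpZ 3 (pexp_powM 1 L)); rewrite subrr add0r in L1.
have L0 := pexp_raise (pexp_raise (pexpZ 2 L)); rewrite addNr add0r in L0.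
eexists; last first.
  apply: pexp_ext (pexpD (pexpD L2 L1) L0) => n n0 /=.
  rewrite /bst_diff ln_succ// powRr1// powR_mulrn// -!natr1; ring.
by rewrite /= /ln1D_coef /=; lra.
Qed.

(** Up to a function with a pure power expansion, [bst_diff] negates log n; this removes a
    logarithmic right-hand side. *)
Lemma bst_diff_ln n : (0 < n)%N ->
  bst_diff (fun n => ln n%:R : R) n = (n%:R + 1) * ln (1 + n%:R^-1) - ln n%:R.
Proof. by move=> n0; rewrite /bst_diff ln_succ// -!natr1; ring. Qed.

Lemma has_pexp_succ_ln1D :
  has_pexp 0 (fun n => (n%:R + 1) * ln (1 + n%:R^-1) : R).
Proof.
have L := pexp_ln1D_lower.
have L1 := pexp_powM 1 L; rewrite subrr in L1.
have L0 := pexp_raise L; rewrite addNr in L0.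
eexists; apply: pexp_ext (pexpD L1 L0) => n n0 /=.
by rewrite powRr1// mulrDl mul1r.
Qed.

Lemma powO_natr_inv (k : nat) : powO (- k%:R) (fun n => n%:R^-1 ^+ k : R).
Proof.
by apply: powO_ext (powO_powR _) => n n0; rewrite powR_opp_nat.
Qed.

Lemma powO_ln1D3 : powO (- 3)
  (fun n => ln (1 + n%:R^-1) - n%:R^-1 + n%:R^-1 ^+ 2 / 2 : R).
Proof.
have := @pexp_ln1D R 3; rewrite sub0r; apply: powO_ext => n n0.
rewrite !big_ord_recr big_ord0 /= !sub0r !powR_opp_nat// /ln1D_coef /=.
by field; rewrite pnatr_neq0.
Qed.

Lemma powO_ln1D4 : powO (- 4) (fun n =>
  ln (1 + n%:R^-1) - n%:R^-1 + n%:R^-1 ^+ 2 / 2 - n%:R^-1 ^+ 3 / 3 : R).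
Proof.
have := @pexp_ln1D R 4; rewrite sub0r; apply: powO_ext => n n0.
rewrite !big_ord_recr big_ord0 /= !sub0r !powR_opp_nat// /ln1D_coef /=.
by field; rewrite pnatr_neq0.
Qed.

Definition harmonic_number n : R := \sum_(1 <= k < n.+1) k%:R^-1.

Lemma harmonic_numberS n :
  harmonic_number n.+1 = harmonic_number n + n.+1%:R^-1.
Proof. by rewrite /harmonic_number big_nat_recr. Qed.

(** The increments of [w] are the trapezoidal errors for 1/x on [n, n + 1], of order n^(-3), so [w]
    converges with error O(n^(-2)). The correction 1/(2n) vanishes in the limit, which is therefore
    Euler's constant. *)
Lemma harmonic_number_expansion : powO (- 2)
  (fun n => harmonic_number n - ln n%:R - n%:R^-1 / 2 - euler_gamma).
Proof.
pose w n : R := harmonic_number n - ln n%:R - n%:R^-1 / 2.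
have wd : powO (- 2 - 1) (fun n => w n.+1 - w n).
  rewrite (_ : - 2 - 1 = - 3 :> R); last by lra.
  have H1 := powOM (powO_natr_inv 2) (@powO_inv_succ R).
  rewrite (_ : - 2 + -1 = - 3 :> R) in H1; last by lra.
  (* The trapezoid (1/n + 1/(n + 1))/2 equals 1/n - 1/(2n^2) + 1/(2n^2(n + 1)). *)
  apply: powO_ext (powOD (powOZ (2^-1) H1) (powOZ (-1) powO_ln1D3)) => n n0.
  rewrite /w harmonic_numberS ln_succ// -!natr1.
  by field; rewrite natr_succ_neq0 pnatr_neq0.
have [//|K KP] := powO_diff_cvg _ wd.
suff -> : euler_gamma = K by [].
apply: cvg_lim => //.
have H1 : powO (-1) (fun n => harmonic_number n - ln n%:R - K).
  have H2 : powO (-1) (fun n => w n - K) by apply: powO_le KP; lra.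
  apply: powO_ext (powOD H2 (powOZ (2^-1) (powO_natr_inv 1))) => n n0.
  by rewrite /w expr1; ring.
have /powO_cvg0 /(_ H1) : -1 < 0 :> R by [].
move/cvg_sub0; apply; exact: cvg_cst.
Qed.

Lemma bigO_of_powO b f g (h : nat -> R) :
  (forall n, (0 < n)%N -> h n = n%:R `^ b) ->
  powO b (fun n => f n - g n) -> f = g +O_\oo h.
Proof.
move=> hb [C H]; apply/eqaddOP; near=> k; near=> n.
have n0 : (0 < n)%N by near: n; exact: nbhs_infty_gt.
rewrite hb// (ger0_norm (powR_ge0 _ _)) fctE; apply: le_trans (H n n0) _.
rewrite ler_wpM2r ?powR_ge0//; near: k; exact: nbhs_pinfty_ge.
Unshelve. all: by end_near. Qed.

End expansions.

(** * The recurrence in difference form and the value of the kernel constant *)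

Section recurrence.
Context {R : realType}.
Variables (t f : nat -> R).
Hypothesis hf : bst_recurrence t f.
Implicit Types (b K : R) (n : nat).

Let T n := f n - t n.

Lemma bst_costE n : (0 < n)%N -> n%:R * T n = 2 * \sum_(0 <= k < n) f k.
Proof.
move=> n0; rewrite /T; have [_ ->//] := hf.
by have := @pnatr_neq0 R _ n0 => ?; field.
Qed.

(** Subtracting consecutive instances of n T(n) = 2 (f(0) + ... + f(n-1)) leaves 2 f(n) = 2 T(n) + 2
    t(n). *)
Lemma bst_diff_cost n : (0 < n)%N -> bst_diff T n = 2 * t n.
Proof.
move=> n0; rewrite /bst_diff bst_costE// big_nat_recr//= mulrDr -bst_costE//.
by rewrite -!natr1 /T; ring.
Qed.

Lemma bst_cost1 : T 1 = 0.
Proof.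
by have := bst_costE (isT : (0 < 1)%N); rewrite big_nat1 (proj1 hf) mulr0 mul1r.
Qed.

Lemma bst_cost_unique u : u 1%N = 0 ->
  (forall n, (0 < n)%N -> bst_diff u n = 2 * t n) ->
  forall n, (0 < n)%N -> T n = u n.
Proof.
move=> u1 du; case=> // n _; elim: n => [|n IH]; first by rewrite u1 bst_cost1.
have := bst_diff_cost (ltn0Sn n); rewrite -du// /bst_diff IH => /addIr.
by apply: mulfI; rewrite pnatr_eq0.
Qed.

Lemma bst_cost_sum n : (0 < n)%N ->
  T n / (n%:R + 1) = 2 * \sum_(1 <= k < n) t k / ((k%:R + 1) * (k%:R + 2)).
Proof.
case: n => // n _; elim: n => [|n IH].
  by rewrite bst_cost1 mul0r big_geq// mulr0.
rewrite big_nat_recr//= mulrDr -IH -[LHS](subrK (T n.+1 / (n.+1%:R + 1))) addrC.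
by rewrite bst_diff_quot bst_diff_cost// invfM mulrA.
Qed.

(** Both sides are the limit of T(n)/(n + 1). The separate [s] allows the series to be written with
    an explicit toll that agrees with [t] at positive indices only. *)
Lemma bst_cost_constant b K (s : nat -> R) : b < 1 ->
  powO b (fun n => T n - K * (n%:R + 1)) ->
  (forall n, (0 < n)%N -> s n = t n / ((n%:R + 1) * (n%:R + 2))) ->
  2 * \big[+%R/0]_(1 <= n <oo) s n = K.
Proof.
move=> b1 H sE.
have H1 : powO (b + -1) (fun n => 2 * \sum_(1 <= k < n) s k - K).
  apply: powO_ext (powOM H (@powO_inv_succ R)) => n n0.
  rewrite mulrBl mulfK ?natr_succ_neq0// bst_cost_sum//; congr (2 * _ - _).
  by apply: eq_big_nat => k /andP[k0 _]; rewrite sE.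
have H2 : (fun n => 2 * \sum_(1 <= k < n) s k) @ \oo --> K.
  have /powO_cvg0 /(_ H1) : b + -1 < 0 by lra.
  by move/cvg_sub0; apply; exact: cvg_cst.
have H3 : (fun n => \sum_(1 <= k < n) s k) @ \oo --> 2^-1 * K.
  rewrite (_ : (fun n => _) = fun n => 2^-1 * (2 * \sum_(1 <= k < n) s k)).
    by apply: cvgM H2; exact: cvg_cst.
  by apply/funext => n; rewrite mulKf// pnatr_eq0.
by rewrite (cvg_lim _ H3)// mulVKf// pnatr_eq0.
Qed.

(** * Power tolls *)

Section power_toll.
Variable alpha : R.
Hypothesis alpha0 : 0 < alpha.
Hypothesis ht : forall n, (0 < n)%N -> t n = n%:R `^ alpha.

Lemma pexp_bst_diff_power_toll :
  pexp alpha (fun i => 2 * (i == 0%N)%:R) (bst_diff T).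
Proof.
apply: pexp_ext (pexpZ 2 (pexp_powR alpha)) => n n0.
by rewrite bst_diff_cost// ht.
Qed.

Lemma full_expansion_power_nonint : (forall k : nat, alpha != k%:R) ->
  full_power_log_expansion f.
Proof.
move=> ak.
have ai (i : nat) : alpha - i%:R != 1 by rewrite subr_eq nat1r; exact: ak.
have [K [c KP]] := bst_diff_solve ai pexp_bst_diff_power_toll.
have /andP[N1 N2] := truncn_itv (ltW alpha0).
set N := Num.truncn alpha in N1 N2.
(* Here N < alpha < N + 1, and the linear factor is the kernel part K (n + 1), without a
   logarithm. *)
apply: (@full_expansion_of_pexp R N alpha false K K); last first.
  apply: pexp_ext (pexpD KP (pexp_powR alpha)) => n n0.
  by rewrite /T -ht// expr0; ring.
- by left.
- by rewrite -natr1 addrK lt_neqAle N1 andbT eq_sym ak.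
Qed.

(** The exponents k + 1, ..., 2 are matched by powers, the exponent 1 by (n + 1) log n. The rest
    starts at exponent 0, so the exponent 1 cannot recur. *)
Lemma full_expansion_power_int (k : nat) : alpha = k.+1%:R ->
  full_power_log_expansion f.
Proof.
move=> ak.
have ai (i : nat) : (i < k)%N -> alpha - i%:R != 1.
  by move=> ik; rewrite ak subr_eq nat1r eqr_nat; lia.
have := pexp_residual ai pexp_bst_diff_power_toll.
rewrite [X in X - k%:R]ak -natr1 addrC addKr.
set d := residual_coef _ _ _; set v := solution_coef _ _ => H1.
have [l l0 lP] := @pexp_bst_diff_succ_ln R.
have H2 := pexp_lower _ (pexpB H1 (pexpZ (d 0%N) lP)).
rewrite l0 mulr1 subrr in H2; have {}H2 := H2 erefl; rewrite subrr in H2.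
pose u n := T n - \sum_(i < k) v i * n%:R `^ (alpha - i%:R)
  - d 0%N * ((n%:R + 1) * ln n%:R).
have [||K [c KP]] := @bst_diff_solve R 0 (fun i => d i.+1 - d 0%N * l i.+1) u.
- by move=> i; rewrite sub0r -subr_eq0 -opprD oppr_eq0 natr1 pnatr_eq0.
- by apply: pexp_ext H2 => n n0; rewrite /bst_diff /u; ring.
(* All logarithms lie in d(0) (n + 1) log n; the kernel part K (n + 1) merges into the integer
   powers. *)
have : has_pexp alpha (fun n => f n - (d 0%N * n%:R + d 0%N) * ln n%:R ^+ true).
  have E1 : has_pexp alpha (fun n => u n - K * (n%:R + 1)).
    by apply: (@has_pexp_raise _ k.+1 0); [rewrite add0r|exists c].
  have E2 : has_pexp alpha (fun n => K * (n%:R + 1)).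
    by apply: has_pexpZ; rewrite ak; exact: has_pexp_succ.
  have E3 : has_pexp alpha (fun n => \sum_(i < k) v i * n%:R `^ (alpha - i%:R)).
    apply: (@has_pexp_sum _ _ _ (fun i n => v i * n%:R `^ (alpha - i%:R))) => i _; apply: has_pexpZ.
    by apply: (@has_pexp_powR _ i); rewrite subrK.
  have E4 : has_pexp alpha t.
    by apply: has_pexp_ext (@has_pexp_powR _ 0 alpha alpha _);
      [move=> n n0; rewrite ht|rewrite addr0].
  apply: has_pexp_ext (has_pexpD (has_pexpD E1 E2) (has_pexpD E3 E4)) => n n0.
  by rewrite /u /T expr1; ring.
move=> [e eP]; apply: (@full_expansion_of_pexp R k alpha true) eP.
- by rewrite ak; lra.
- by right.
Qed.

Lemma full_expansion_power : full_power_log_expansion f.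
Proof.
have [[k ak]|H] := pselect (exists k : nat, alpha = k%:R).
  case: k ak => [a0|k]; last exact: full_expansion_power_int.
  by move: alpha0; rewrite a0 ltxx.
by apply: full_expansion_power_nonint => k; apply/eqP => ak; apply: H; exists k.
Qed.

(** The subtracted term cancels the leading term of 2 n^alpha; adding the toll back turns 2/(alpha -
    1) into (alpha + 1)/(alpha - 1). *)
Let U n := T n - 2 / (alpha - 1) * n%:R `^ alpha.

Let powO_bst_diff_U : alpha != 1 -> powO (alpha - 1) (bst_diff U).
Proof.
move=> a1; have a1' : alpha - 1 != 0 by rewrite subr_eq0.
have := powOZ (- (2 / (alpha - 1))) (@pexp_bst_diff_powR R alpha 1%N).
apply: powO_ext => n n0.
rewrite big_ord1 /= bst_diff_coef0 subr0 /U bst_diffB bst_diffZ.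
by rewrite bst_diff_cost// ht//; field.
Qed.

Let fE n : alpha != 1 -> (0 < n)%N ->
  f n = U n + (alpha + 1) / (alpha - 1) * n%:R `^ alpha.
Proof.
move=> a1 n0; have a1' : alpha - 1 != 0 by rewrite subr_eq0.
by rewrite /U /T ht//; field.
Qed.

Lemma power_toll_gt2 : 2 < alpha ->
  f = (fun n : nat => (alpha + 1) / (alpha - 1) * n%:R `^ alpha)
      +O_\oo (fun n : nat => n%:R `^ (alpha - 1) : R).
Proof.
move=> a2; have a1 : alpha != 1 by rewrite gt_eqF//; lra.
apply: bigO_of_powO => //.
have : powO (alpha - 1) U.
  by apply: powO_bst_diff_gt1 (powO_bst_diff_U a1); lra.
by apply: powO_ext => n n0; rewrite fE// addrK.
Qed.

Lemma power_toll_lt2 : alpha != 1 -> alpha < 2 ->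
  exists K, powO (alpha - 1) (fun n => U n - K * (n%:R + 1)).
Proof.
by move=> a1 a2; apply: powO_bst_diff_lt1 (powO_bst_diff_U a1); lra.
Qed.

Lemma power_toll_12 : 1 < alpha < 2 -> exists K : R,
  f = (fun n : nat => (alpha + 1) / (alpha - 1) * n%:R `^ alpha + K * n%:R)
      +O_\oo (fun n : nat => n%:R `^ (alpha - 1) : R).
Proof.
move=> /andP[a1 a2]; have a1' : alpha != 1 by rewrite gt_eqF.
have [K KP] := power_toll_lt2 a1' a2; exists K.
apply: bigO_of_powO => //.
(* Since alpha - 1 > 0, the constant part of K (n + 1) is absorbed by the error. *)
have cst : powO (alpha - 1) (fun=> K).
  apply: (@powO_le _ 0); first lra.
  by apply: powO_ext (powOZ K (@powO_powR R 0)) => n n0; rewrite powRr0 mulr1.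
by apply: powO_ext (powOD KP cst) => n n0; rewrite fE//; ring.
Qed.

(** The error O(n^(alpha-1)) now tends to 0, so both terms of K (n + 1) remain visible. *)
Lemma power_toll_lt1 : alpha < 1 ->
  f = (fun n : nat => K_pow alpha * n%:R
         + (alpha + 1) / (alpha - 1) * n%:R `^ alpha + K_pow alpha)
      +o_\oo (fun _ : nat => 1 : R).
Proof.
move=> a1; have a1' : alpha != 1 by rewrite lt_eqF.
have [|K KP] := power_toll_lt2 a1'; first lra.
have -> : K_pow alpha = K.
  apply: (bst_cost_constant a1); last by move=> n n0; rewrite ht.
  (* Passing from [U] back to [T] costs O(n^alpha), which is still below the order of n + 1. *)
  have KP' : powO alpha (fun n => U n - K * (n%:R + 1)) by apply: powO_le KP; lra.
  apply: powO_ext (powOD KP' (powOZ (2 / (alpha - 1)) (@powO_powR R alpha))) => n n0.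
  by rewrite /U; ring.
have /powO_cvg0 /(_ KP) : alpha - 1 < 0 by rewrite subr_lt0.
move=> /cvgrPdist_le H; apply/eqaddoP => eps e0.
have := H eps e0; apply: filter_app; near=> n => Hn.
have n0 : (0 < n)%N by near: n; exact: nbhs_infty_gt.
move: Hn; rewrite sub0r normrN normr1 mulr1 !fctE fE//; apply: le_trans.
by rewrite le_eqVlt; apply/orP; left; apply/eqP; congr `|_|; ring.
Unshelve. all: by end_near. Qed.

End power_toll.

Let harmonic_rest n : R :=
  harmonic_number n - ln n%:R - n%:R^-1 / 2 - euler_gamma.

Let powO_harmonic_rest_succ : powO (-1) (fun n => (n%:R + 1) * harmonic_rest n).
Proof.
have := powOM (@powO_succ R) (@harmonic_number_expansion R).
by rewrite (_ : 1 + - 2 = -1 :> R)//; lra.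
Qed.

Lemma linear_toll_cost : (forall n, (0 < n)%N -> t n = n%:R) ->
  f = (fun n : nat => 2 * n%:R * ln n%:R + (2 * euler_gamma - 3) * n%:R
         + 2 * ln n%:R + 2 * euler_gamma + 1)
      +O_\oo (fun n : nat => 1 / n%:R : R).
Proof.
move=> ht.
(* [bst_diff] sends (n + 1) H(n) to n + 2 and n to 1, so this combination gives 2n. *)
have TE := @bst_cost_unique (fun n => 2 * (n%:R + 1) * harmonic_number n - 4 * n%:R).
apply: (@bigO_of_powO _ (-1)).
  by move=> n n0; rewrite powR_inv1// div1r.
(* The term 1/(2n) of H(n) contributes 2(n + 1)/(2n) = 1 + 1/n: the constant 1 and one more error
   term. *)
apply: powO_ext (powOD (powOZ 2 powO_harmonic_rest_succ) (powO_natr_inv 1)) => n n0.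
rewrite -[f n](subrK (t n)) -/(T n) TE//.
- by rewrite ht// /harmonic_rest expr1; field; rewrite pnatr_neq0.
- by rewrite /harmonic_number big_nat1 invr1; lra.
- move=> m m0; rewrite ht// /bst_diff harmonic_numberS -!natr1.
  by field; rewrite natr_succ_neq0.
Qed.

Lemma quadratic_toll_cost : (forall n, (0 < n)%N -> t n = n%:R ^+ 2) ->
  f = (fun n : nat => 3 * n%:R ^+ 2 - 6 * n%:R * ln n%:R
         + (10 - 6 * euler_gamma) * n%:R)
      +O_\oo (fun n : nat => ln n%:R : R).
Proof.
move=> ht.
(* [bst_diff] sends n^2 to n^2 + 3n + 1; the multiples 10 of n and -6 of (n + 1) H(n) cancel the
   excess 6n + 2. *)
have TE := @bst_cost_unique
  (fun n => 2 * n%:R ^+ 2 + 10 * n%:R - 6 * (n%:R + 1) * harmonic_number n).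
(* Adding back 6 log n leaves a bounded error; C + 6 log n <= (C + 6) log n once log n >= 1. *)
have [C CP] : powO 0 (fun n => f n - (3 * n%:R ^+ 2 - 6 * n%:R * ln n%:R
    + (10 - 6 * euler_gamma) * n%:R) + 6 * ln n%:R).
  have H1 : powO 0 (fun n => (n%:R + 1) * harmonic_rest n).
    by apply: powO_le powO_harmonic_rest_succ; lra.
  have H2 : powO 0 (fun n => n%:R^-1 ^+ 1 : R).
    by apply: powO_le (powO_natr_inv 1); lra.
  have H3 := @powO_powR R 0.
  apply: powO_ext (powOD (powOZ (- 6) H1) (powOD (powOZ (- 3) H2)
    (powOZ (- 3 - 6 * euler_gamma) H3))) => n n0.
  rewrite -[f n](subrK (t n)) -/(T n) TE//.
  - by rewrite ht// /harmonic_rest expr1 powRr0; field; rewrite pnatr_neq0.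
  - by rewrite /harmonic_number big_nat1 invr1; lra.
  - move=> m m0; rewrite ht// /bst_diff harmonic_numberS -!natr1.
    by field; rewrite natr_succ_neq0.
apply/eqaddOP; near=> k; near=> n.
have n0 : (0 < n)%N by near: n; exact: nbhs_infty_gt.
have l1 : 1 <= ln n%:R :> R by near: n; exact: ln_large.
have C0 : 0 <= C by have := CP 1%N isT; rewrite powR1 mulr1; apply: le_trans.
have kC : C + 6 <= k by near: k; apply: nbhs_pinfty_ge; exact: num_real.
rewrite fctE (@ger0_norm _ (ln _)); last by lra.
have := CP n n0; rewrite powRr0 mulr1; set z := _ - _ => zC.
have : `|z| <= C + 6 * ln n%:R.
  rewrite -[z](addrK (6 * ln n%:R)); apply: le_trans (ler_normB _ _) _.
  by rewrite lerD// ger0_norm//; lra.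
by nra.
Unshelve. all: by end_near. Qed.

(** * The logarithmic toll *)

Section log_toll.
Hypothesis ht : forall n, (0 < n)%N -> t n = ln n%:R.

Lemma full_expansion_log : full_power_log_expansion f.
Proof.
have [c cP] := has_pexpZ 2 (@has_pexp_succ_ln1D R).
(* Adding 2 log n cancels the logarithm in [bst_diff T] and leaves 2(n + 1) log (1 + 1/n). *)
pose u n := T n + 2 * ln n%:R.
have [||K [d KP]] := @bst_diff_solve R 0 c u.
- by move=> i; rewrite sub0r -subr_eq0 -opprD oppr_eq0 natr1 pnatr_eq0.
- apply: pexp_ext cP => n n0.
  by rewrite bst_diffD bst_diffZ bst_diff_ln// bst_diff_cost// ht//; ring.
have E1 : has_pexp 1 (fun n => u n - K * (n%:R + 1)).
  by apply: (@has_pexp_raise _ 1 0); [rewrite add0r|exists d].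
have [e eP] := has_pexpD E1 (has_pexpZ K (@has_pexp_succ R 0)).
(* The toll log n and the -2 log n of [T] add up to -log n, hence the linear factor 0 n - 1. *)
apply: (@full_expansion_of_pexp R 0 1 true 0 (-1)); [lra|by right|].
by apply: pexp_ext eP => n n0; rewrite /u /T ht// expr1; ring.
Qed.

Lemma log_toll_cost :
  f = (fun n : nat => K_log * n%:R - ln n%:R + (K_log - 2)
         - 1 / (2 * n%:R) + 1 / (9 * n%:R ^+ 2))
      +O_\oo (fun n : nat => 1 / n%:R ^+ 3 : R).
Proof.
(* The last three coefficients cancel the orders n^0, n^(-1), n^(-2) in [bst_diff] of T - v, after
   -2 log n has cancelled the logarithm. *)
pose v n : R := - 2 * ln n%:R - 2 - n%:R^-1 / 2 + n%:R^-1 ^+ 2 / 9.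
have H : powO (- 3) (bst_diff (fun n => T n - v n)).
  have H1 := powOM (@powO_succ R) (@powO_ln1D4 R).
  rewrite (_ : 1 + - 4 = - 3 :> R) in H1; last by lra.
  have H2 := powOM (powO_natr_inv 2) (@powO_inv_succ R).
  rewrite (_ : - 2 + -1 = - 3 :> R) in H2; last by lra.
  apply: powO_ext (powOD (powOZ 2 H1) (powOD (powOZ (- (1 / 9)) H2)
    (powOZ (2 / 3) (@powO_natr_inv R 3)))) => n n0.
  rewrite bst_diffB bst_diff_cost// ht// /bst_diff /v ln_succ// -!natr1.
  by field; rewrite natr_succ_neq0 pnatr_neq0.
have [|K KP] := powO_bst_diff_lt1 _ H; first lra.
have -> : K_log = K.
  (* Any exponent strictly between 0 and 1 would do: it bounds log n, hence [v], and stays below the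
     order of n + 1. *)
  have h1 : 2^-1 < 1 :> R by lra.
  apply: (bst_cost_constant h1); last by move=> n n0; rewrite ht.
  have KP' : powO (2^-1) (fun n => T n - v n - K * (n%:R + 1)).
    by apply: powO_le KP; lra.
  have L : powO (2^-1) (fun n => ln n%:R : R).
    exists (2^-1)^-1 => n n0; rewrite ger0_norm ?ln_natr_ge0//.
    by apply: ln_le_powR => //; lra.
  have C0 : powO (2^-1) (fun n => n%:R `^ 0 : R).
    by apply: powO_le (powO_powR _); lra.
  have C1 : powO (2^-1) (fun n => n%:R^-1 ^+ 1 : R).
    by apply: powO_le (powO_natr_inv 1); lra.
  have C2 : powO (2^-1) (fun n => n%:R^-1 ^+ 2 : R).
    by apply: powO_le (powO_natr_inv 2); lra.
  apply: powO_ext (powOD KP' (powOD (powOD (powOZ (- 2) L) (powOZ (- 2) C0))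
    (powOD (powOZ (- 2^-1) C1) (powOZ (9^-1) C2)))) => n n0.
  by rewrite /v powRr0; field; rewrite pnatr_neq0.
apply: (@bigO_of_powO _ (- 3)).
  by move=> n n0; rewrite powR_opp_nat// exprVn div1r.
apply: powO_ext KP => n n0.
by rewrite /v /T ht//; field; rewrite pnatr_neq0.
Qed.

End log_toll.
End recurrence.

Theorem theorem6 (R : realType) (t f : nat -> R)
    (ht0 : t 0%N = 0) (hf : bst_recurrence t f) :
  (forall alpha : R, 0 < alpha ->
     (forall n : nat, (1 <= n)%N -> t n = n%:R `^ alpha) ->
     full_power_log_expansion f
     /\ (2 < alpha ->
          f = (fun n : nat => (alpha + 1) / (alpha - 1) * n%:R `^ alpha)
              +O_\oo (fun n : nat => n%:R `^ (alpha - 1) : R))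
     /\ (alpha = 2 ->
          f = (fun n : nat => 3 * n%:R ^+ 2 - 6 * n%:R * ln n%:R
                              + (10 - 6 * euler_gamma) * n%:R)
              +O_\oo (fun n : nat => ln n%:R : R))
     /\ (1 < alpha < 2 ->
          exists K : R,
            f = (fun n : nat => (alpha + 1) / (alpha - 1) * n%:R `^ alpha
                                + K * n%:R)
                +O_\oo (fun n : nat => n%:R `^ (alpha - 1) : R))
     /\ (alpha = 1 ->
          f = (fun n : nat => 2 * n%:R * ln n%:R
                              + (2 * euler_gamma - 3) * n%:R
                              + 2 * ln n%:R + 2 * euler_gamma + 1)
              +O_\oo (fun n : nat => 1 / n%:R : R))
     /\ (alpha < 1 ->
          f = (fun n : nat => K_pow alpha * n%:R
                              + (alpha + 1) / (alpha - 1) * n%:R `^ alpha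
                              + K_pow alpha)
              +o_\oo (fun _ : nat => 1 : R)))
  /\
  ((forall n : nat, (1 <= n)%N -> t n = ln n%:R) ->
     full_power_log_expansion f
     /\ f = (fun n : nat => K_log * n%:R - ln n%:R + (K_log - 2)
                            - 1 / (2 * n%:R) + 1 / (9 * n%:R ^+ 2))
            +O_\oo (fun n : nat => 1 / n%:R ^+ 3 : R)).
Proof.
split=> [alpha a0 ht|ht]; last first.
  by split; [exact: full_expansion_log hf ht|exact: log_toll_cost hf ht].
do 5?split.
- exact: (full_expansion_power hf a0 ht).
- exact: (power_toll_gt2 hf ht).
- move=> a2; apply: (quadratic_toll_cost hf) => n n0.
  by rewrite ht// a2 powR_mulrn.
- exact: (power_toll_12 hf ht).
- by move=> a1; apply: (linear_toll_cost hf) => n n0; rewrite ht// a1 powRr1.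
- exact: (power_toll_lt1 hf ht).
Qed.
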